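(* The Efficient Domination problem can be solved in polynomial time on $P_9$-free bipartite graphs with maximum vertex degree at most $3$.
   Context: For a graph $G=(V,E)$ and $v\in V$, $N[v]$ is the closed neighborhood of $v$. A set $D\subseteq V$ is an efficient dominating set (e.d.s.) if $|N[v]\cap D|=1$ for every $v\in V$; the Efficient Domination problem asks whether $G$ has an e.d.s. $P_9$ is the chordless path on 9 vertices; a graph is $H$-free if it has no induced subgraph isomorphic to $H$. *)

(* Defs.v *)
From mathcomp Require Import all_boot all_order all_algebra.

Set Implicit Arguments.
Unset Strict Implicit.
Unset Printing Implicit Defensive.

Record sgraph := SGraph {
  vertex :> finType;
  edge : rel vertex;
  edge_sym : symmetric edge;
  edge_irrefl : irreflexive edge
}.

Definition closed_nbhd (G : sgraph) (v : G) : {set G} :=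
  [set u | (u == v) || edge v u].

Definition efficient_dominating_set (G : sgraph) (D : {set G}) : Prop :=
  forall v : G, #|closed_nbhd v :&: D| = 1.

Definition has_eds (G : sgraph) : Prop :=
  exists D : {set G}, efficient_dominating_set D.

Definition degree (G : sgraph) (v : G) : nat := #|[set u | edge v u]|.

Definition max_degree (G : sgraph) : nat := \max_(v : G) degree v.

Definition bipartite (G : sgraph) : Prop :=
  exists A : {set G}, forall x y : G, edge x y -> (x \in A) != (y \in A).

Section Induced.
Variables (G : sgraph) (S : {set G}).

Definition induced_edge : rel {x : G | x \in S} :=
  fun x y => edge (val x) (val y).

Lemma induced_edge_sym : symmetric induced_edge.
Proof. by move=> x y; apply: edge_sym. Qed.

Lemma induced_edge_irrefl : irreflexive induced_edge.
Proof. by move=> x; apply: edge_irrefl. Qed.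

Definition induced : sgraph := SGraph induced_edge_sym induced_edge_irrefl.

End Induced.

Definition isomorphic (G H : sgraph) : Prop :=
  exists2 f : G -> H, bijective f & forall x y, edge (f x) (f y) = edge x y.

Definition induced_free (H G : sgraph) : Prop :=
  forall S : {set G}, ~ isomorphic (induced S) H.

Section PathGraph.
Variable n : nat.

Definition path_edge : rel 'I_n :=
  fun i j => (i.+1 == j :> nat) || (j.+1 == i :> nat).

Lemma path_edge_sym : symmetric path_edge.
Proof. by move=> i j; rewrite /path_edge orbC. Qed.

Lemma path_edge_irrefl : irreflexive path_edge.
Proof. by move=> i; rewrite /path_edge orbb gtn_eqF. Qed.

Definition path_graph : sgraph := SGraph path_edge_sym path_edge_irrefl.

End PathGraph.

Inductive move := MoveL | MoveN | MoveR.

Definition shift (m : move) : int :=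
  match m with MoveL => (-1)%R | MoveN => 0%R | MoveR => 1%R end.

(** A cell contains [Some a] for a letter [a], or [None], the blank.
    The tape alphabet contains a copy of the input alphabet [Sigma]; tape
    [ord0] is the one that initially holds the input. A state [q] with
    [answer q = Some b] is halting, and accepting iff [b]. *)
Record machine (Sigma : finType) := Machine {
  work_tapes : nat;
  letter : finType;
  inject : Sigma -> letter;
  inject_inj : injective inject;
  state : finType;
  start : state;
  answer : state -> option bool;
  trans : state -> {ffun 'I_work_tapes.+1 -> option letter} ->
          state * {ffun 'I_work_tapes.+1 -> option letter * move}
}.

Section Run.
Variables (Sigma : finType) (M : machine Sigma).

(** Tapes are infinite in both directions. *)
Record config := Config {
  cstate : state M;
  tape : 'I_(work_tapes M).+1 -> int -> option (letter M);
  head_pos : 'I_(work_tapes M).+1 -> int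
}.

Definition init (w : seq Sigma) : config :=
  Config (start M)
    (fun i z => match z with
                | Posz k => if i == ord0 then onth (map (@inject _ M) w) k
                            else None
                | Negz _ => None
                end)
    (fun _ => 0%R).

(** Halting configurations are fixed points of [step]. *)
Definition step (c : config) : config :=
  if answer (cstate c) is Some _ then c
  else
    let: (q, act) := trans (cstate c) [ffun i => tape c i (head_pos c i)] in
    Config q
      (fun i z => if z == head_pos c i then (act i).1 else tape c i z)
      (fun i => (head_pos c i + shift (act i).2)%R).

Definition halts_within (w : seq Sigma) (t : nat) (b : bool) : Prop :=
  answer (cstate (iter t step (init w))) = Some b.

End Run.

(** The adjacency matrix, row by row in the order of [enum G]: [Some b] is the
    bit [b], and [None] is a symbol # that ends each row. *)
Definition encode (G : sgraph) : seq (option bool) :=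
  flatten [seq rcons [seq Some (edge x y) | y <- enum G] None | x <- enum G].

(** On inputs that do not encode a graph of the class, the machine is
    unconstrained. *)
Definition polytime_solvable_on (problem class : sgraph -> Prop) : Prop :=
  exists (M : machine (option bool)) (p : {poly nat}),
    forall G : sgraph, class G ->
      exists2 b : bool, halts_within M (encode G) p.[size (encode G)]%R b
                      & (b <-> problem G).

(* Main.v *)
(** In a graph of maximum degree 3 whose geodesics have at most 8 vertices, every
    component has at most 4^7 =: K vertices. Hence the graph has an e.d.s. iff,
    for every K-tuple of vertices that is closed under adjacency, the induced
    subgraph on the tuple has one; this depends only on the equalities and
    adjacencies between the entries, so it can be read from a table of constant
    size. A Turing machine with three tapes runs through the at most n^K tuples as
    an odometer. A tuple [x] is stored on the two work tapes by writing
    [{i | x i = r}] in cell [r]; one sweep over the adjacency matrix, with one work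
    head following the row and the other the column, collects in the finite control
    the set of all triples (matrix bit, row marks, column marks), which determines
    equalities, adjacencies and closedness. *)

Require Import Defs.
From HB Require Import structures.
From mathcomp Require Import all_boot all_order all_algebra.
From mathcomp Require Import zify.

Set Implicit Arguments.
Unset Strict Implicit.
Unset Printing Implicit Defensive.

Import GRing.Theory.

(** * Adjacency matrices over the natural numbers as words *)

Definition matrix_word (n : nat) (e : nat -> nat -> bool) : seq (option bool) :=
  flatten [seq rcons [seq Some (e r c) | c <- iota 0 n] None | r <- iota 0 n].

Section MatrixWord.
Variables (n : nat) (e : nat -> nat -> bool).

Let row r := rcons [seq Some (e r c) | c <- iota 0 n] None.

Let size_row r : size (row r) = n.+1.
Proof. by rewrite size_rcons size_map size_iota. Qed.

Let onth_rows m k r c : r < m -> c < n.+1 ->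
  onth (flatten [seq row i | i <- iota k m]) (r * n.+1 + c) =
  onth (row (k + r)) c.
Proof.
elim: m k r => // m IH k [|r] ltrm ltcn; rewrite [flatten _]/= onth_cat size_row.
  by rewrite mul0n add0n ltcn addn0.
rewrite ifN; last by rewrite -leqNgt mulSn -addnA leq_addr.
by rewrite mulSn -addnA addKn IH // addSnnS.
Qed.

Lemma size_matrix_word : size (matrix_word n e) = n * n.+1.
Proof.
suff size_rows m k : size (flatten [seq row i | i <- iota k m]) = m * n.+1.
  exact: size_rows.
by elim: m k => // m IH k; rewrite /= size_cat size_row IH mulSn.
Qed.

Lemma matrix_word_bit r c : r < n -> c < n ->
  onth (matrix_word n e) (r * n.+1 + c) = Some (Some (e r c)).
Proof.
move=> ltrn ltcn; rewrite onth_rows ?leqW // add0n onthE.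
by rewrite (nth_map None) ?size_row ?leqW // nth_rcons size_map size_iota ltcn
  (nth_map 0) ?size_iota // nth_iota.
Qed.

Lemma matrix_word_sep r : r < n ->
  onth (matrix_word n e) (r * n.+1 + n) = Some None.
Proof.
move=> ltrn; rewrite onth_rows // add0n onthE.
by rewrite (nth_map None) ?size_row // nth_rcons size_map size_iota ltnn eqxx.
Qed.

Lemma matrix_word_end : onth (matrix_word n e) (n * n.+1) = None.
Proof. by rewrite onthE nth_default // size_map size_matrix_word. Qed.

End MatrixWord.

(** * The machine *)

Section TupleMachine.
Variable K : nat.

Notation marks := {set 'I_K}.
Notation view := (bool * marks * marks)%type.

Variable good : {set view} -> bool.

(* [Rewind true k] first leaves the cell to the right of the data, and [k] tells
   what comes after the rewinding. [Sweep V Z] and [Return V Z] carry the views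
   collected so far and the marks of the last row visited: at the end of the sweep
   [Z] is the set of digits that have reached their maximum. [Increment j first
   carry] increments digit [j] and resets the digits below it; [carry] means that
   the mark [j] was just erased and belongs to the current cell. *)
Inductive phase :=
  | Init of bool
  | Rewind of bool & option 'I_K
  | Sweep of {set view} & marks
  | Return of {set view} & marks
  | Increment of 'I_K & bool & bool
  | Halt of bool.

Definition phase_code (q : phase) :
    bool + bool * option 'I_K + {set view} * marks + {set view} * marks +
    'I_K * bool * bool + bool :=
  match q with
  | Init b => inl (inl (inl (inl (inl b))))
  | Rewind b k => inl (inl (inl (inl (inr (b, k)))))
  | Sweep V Z => inl (inl (inl (inr (V, Z))))
  | Return V Z => inl (inl (inr (V, Z)))
  | Increment j a b => inl (inr (j, a, b))
  | Halt b => inr b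
  end.

Definition phase_decode c : phase :=
  match c with
  | inl (inl (inl (inl (inl b)))) => Init b
  | inl (inl (inl (inl (inr (b, k))))) => Rewind b k
  | inl (inl (inl (inr (V, Z)))) => Sweep V Z
  | inl (inl (inr (V, Z))) => Return V Z
  | inl (inr (j, a, b)) => Increment j a b
  | inr b => Halt b
  end.

Lemma phase_codeK : cancel phase_code phase_decode.
Proof. by case. Qed.

HB.instance Definition _ := Finite.copy phase (can_type phase_codeK).

(** A rewinding head that has reached its blank waits there, so heads at different distances get
    synchronized. *)
Definition back T (o : option T) := if o is Some _ then MoveL else MoveN.

Definition after_rewind (k : option 'I_K) : phase :=
  if k is Some j then Increment j true false else Sweep set0 set0.

(** When [Z] is the set of digits at their maximum, the picked [j] is the least digit that can still
    grow. If there is none, the last tuple has passed the test. *)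
Definition after_sweep (V : {set view}) (Z : marks) : phase :=
  if good V then
    if [pick j | (j \notin Z) && [forall i : 'I_K, (i < j) ==> (i \in Z)]]
      is Some j then Rewind true (Some j) else Halt true
  else Halt false.

Definition incr_marks (j : 'I_K) (first carry : bool) (s : marks) : marks :=
  [set i : 'I_K | if i < j then first else if i == j then carry else i \in s].

Definition delta (q : phase) (a : option (option bool)) (r c : option marks) :
    phase * move * (option marks * move) * (option marks * move) :=
  match q with
  | Init first =>
      match a with
      | Some (Some _) =>
          let s := Some (if first then setT else set0) in
          (Init false, MoveR, (s, MoveR), (s, MoveR))
      | Some None => (Rewind true None, MoveN, (r, MoveN), (c, MoveN))
      | None => (Halt true, MoveN, (r, MoveN), (c, MoveN))
      end
  | Rewind true k => (Rewind false k, MoveL, (r, MoveL), (c, MoveL))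
  | Rewind false k =>
      if [&& ~~ isSome a, ~~ isSome r & ~~ isSome c]
      then (after_rewind k, MoveR, (r, MoveR), (c, MoveR))
      else (q, back a, (r, back r), (c, back c))
  | Sweep V Z =>
      match a with
      | Some (Some b) =>
          (Sweep (V :|: [set (b, odflt set0 r, odflt set0 c)]) Z,
           MoveR, (r, MoveN), (c, MoveR))
      | Some None =>
          (Return V (odflt set0 r), MoveR, (r, MoveR), (c, MoveL))
      | None => (after_sweep V Z, MoveN, (r, MoveN), (c, MoveN))
      end
  | Return V Z =>
      if c is Some _ then (q, MoveN, (r, MoveN), (c, MoveL))
      else (Sweep V Z, MoveN, (r, MoveN), (c, MoveR))
  | Increment j first carry =>
      if r is Some s then
        let s' := Some (incr_marks j first carry s) in
        (Increment j false (j \in s), MoveN, (s', MoveR), (s', MoveR))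
      else (Rewind true None, MoveN, (r, MoveN), (c, MoveN))
  | Halt _ => (q, MoveN, (r, MoveN), (c, MoveN))
  end.

(** All tapes share one alphabet: the input tape is read through the first component, the work tapes
    through the second. *)
Let letterT : finType := (option bool * marks)%type.
Let i0 : 'I_3 := @Ordinal 3 0 isT.
Let i1 : 'I_3 := @Ordinal 3 1 isT.
Let i2 : 'I_3 := @Ordinal 3 2 isT.

Definition tuple_trans (q : phase) (rd : {ffun 'I_3 -> option letterT}) :
    phase * {ffun 'I_3 -> option letterT * move} :=
  let: (q', m0, (s1, m1), (s2, m2)) :=
    delta q (omap fst (rd i0)) (omap snd (rd i1)) (omap snd (rd i2)) in
  (q', [ffun i : 'I_3 => match val i with
                         | 0 => (rd i0, m0)
                         | 1 => (omap (pair None) s1, m1)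
                         | _ => (omap (pair None) s2, m2)
                         end]).

Lemma pair_set0_inj : injective (fun a : option bool => (a, set0 : marks)).
Proof. by move=> a b []. Qed.

Definition tuple_machine : machine (option bool) :=
  @Machine _ 2 letterT _ pair_set0_inj phase (Init true)
    (fun q => if q is Halt b then Some b else None) tuple_trans.

(** * Execution *)

Section Execution.
Variables (n : nat) (e : nat -> nat -> bool).

Notation w := (matrix_word n e).
Notation conf := (config tuple_machine).
Implicit Types (C : conf) (f g : nat -> option marks).

(* Head positions and cells are shifted by one: [h : nat] stands for the cell
   [h - 1], so that [0] is the blank cell to the left of the data. *)
Definition pos (h : nat) : int := (h%:Z - 1)%R.

Lemma pos_inj : injective pos.
Proof. by rewrite /pos => h h'; lia. Qed.

(** A relation, since [MoveL] has no target from cell [0]: heads never leave the represented part of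
    a tape. *)
Definition moves (m : move) (h h' : nat) : bool :=
  match m with MoveL => h == h'.+1 | MoveN => h == h' | MoveR => h.+1 == h' end.

Lemma pos_shift m h h' : moves m h h' -> (pos h + shift m)%R = pos h'.
Proof. by case: m => /= /eqP; rewrite /pos; lia. Qed.

Definition input (h : nat) : option (option bool) :=
  if h is k.+1 then onth w k else None.
Arguments input : simpl never.

(** Tapes are functions, so their contents are described cell by cell, and only in the cells and
    letter components that [delta] can read. *)
Record rep (q : phase) f1 f2 (a r c : nat) C : Prop := Rep {
  rep_state : cstate C = q;
  rep_input : forall h, omap fst (tape C i0 (pos h)) = input h;
  rep_row : forall h, omap snd (tape C i1 (pos h)) = f1 h;
  rep_col : forall h, omap snd (tape C i2 (pos h)) = f2 h;
  rep_head0 : head_pos C i0 = pos a;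
  rep_head1 : head_pos C i1 = pos r;
  rep_head2 : head_pos C i2 = pos c }.

Definition write f h s h' := if h' == h then s else f h'.

Definition goes (t : nat) (P Q : conf -> Prop) :=
  forall C, P C -> exists2 k, k <= t & Q (iter k (@step _ tuple_machine) C).

Lemma goes_trans t1 t2 (P Q R : conf -> Prop) :
  goes t1 P Q -> goes t2 Q R -> goes (t1 + t2) P R.
Proof.
move=> PQ QR C /PQ[k1 le1 /QR[k2 le2 RC]].
by exists (k2 + k1); [lia | rewrite iterD].
Qed.

Lemma goes_rcons t (P Q R : conf -> Prop) :
  goes t P Q -> goes 1 Q R -> goes t.+1 P R.
Proof. by rewrite -[t.+1]addn1; apply: goes_trans. Qed.

Lemma goes_cons t (P Q R : conf -> Prop) :
  goes 1 P Q -> goes t Q R -> goes t.+1 P R.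
Proof. exact: goes_trans. Qed.

Lemma goes_weak t t' (P Q : conf -> Prop) :
  t <= t' -> goes t P Q -> goes t' P Q.
Proof. by move=> le PQ C /PQ[k lek QC]; exists k => //; lia. Qed.

Lemma goes_refl t (P Q : conf -> Prop) : (forall C, P C -> Q C) -> goes t P Q.
Proof. by move=> PQ C /PQ QC; exists 0. Qed.

Lemma rep_ext q f1 f2 g1 g2 a r c C :
  f1 =1 g1 -> f2 =1 g2 -> rep q f1 f2 a r c C -> rep q g1 g2 a r c C.
Proof.
move=> eq1 eq2 [sq s0 s1 s2 h0 h1 h2]; split=> // h.
  by rewrite -eq1.
by rewrite -eq2.
Qed.

Definition running (q : phase) := if q is Halt _ then false else true.

Lemma goes_step q f1 f2 a r c a' r' c' q' m0 m1 m2 s1 s2 g1 g2 :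
  running q ->
  delta q (input a) (f1 r) (f2 c) = (q', m0, (s1, m1), (s2, m2)) ->
  [&& moves m0 a a', moves m1 r r' & moves m2 c c'] ->
  write f1 r s1 =1 g1 -> write f2 c s2 =1 g2 ->
  goes 1 (rep q f1 f2 a r c)
         (rep q' g1 g2 a' r' c').
Proof.
move=> run_q Dd /and3P[ok0 ok1 ok2] eq1 eq2 C [sq t0 t1 t2 h0 h1 h2].
exists 1 => //=; apply: rep_ext eq1 eq2 _; rewrite /step sq /=.
have -> : (if q is Halt b then Some b else None) = None by case: (q) run_q.
rewrite /tuple_trans !ffunE h0 h1 h2 t0 t1 t2 Dd.
split=> //= [h|h|h|||]; rewrite ?ffunE /= ?h0 ?h1 ?h2 //; try exact: pos_shift.
all: rewrite (inj_eq pos_inj) ?/write.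
- by case: eqP => [->|_]; rewrite t0.
- by case: eqP => _; rewrite ?t1 //; case: (s1).
- by case: eqP => _; rewrite ?t2 //; case: (s2).
Qed.

Lemma write_id f h : write f h (f h) =1 f.
Proof. by rewrite /write => h' /=; case: eqP => // ->. Qed.

Implicit Types (x y : 'I_K -> nat).

Lemma goes_scan q f1 f2 a r c a' r' c' q' m0 m1 m2 :
  running q ->
  delta q (input a) (f1 r) (f2 c) = (q', m0, (f1 r, m1), (f2 c, m2)) ->
  [&& moves m0 a a', moves m1 r r' & moves m2 c c'] ->
  goes 1 (rep q f1 f2 a r c)
         (rep q' f1 f2 a' r' c').
Proof. by move=> run Dd ok; apply: goes_step run Dd ok _ _; apply: write_id. Qed.

(** * Tuples as tape contents, rewinding and initialization *)

Definition marks_at x r : marks := [set i | x i == r].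

Definition marked x (h : nat) : option marks :=
  if 0 < h <= n then Some (marks_at x h.-1) else None.

Lemma marked_isSome x h : isSome (marked x h) = (0 < h <= n).
Proof. by rewrite /marked; case: ifP. Qed.

Lemma input_isSome h : isSome (input h) = (0 < h <= n * n.+1).
Proof.
by case: h => // k; rewrite /input -(size_matrix_word n e); elim: (w) k => [|a s IH] [].
Qed.

Lemma input_bit r c : r < n -> c < n ->
  input (r * n.+1 + c).+1 = Some (Some (e r c)).
Proof. exact: matrix_word_bit. Qed.

Lemma input_sep r : r < n -> input (r * n.+1 + n).+1 = Some None.
Proof. exact: matrix_word_sep. Qed.

Lemma input_end : input (n * n.+1).+1 = None.
Proof. exact: matrix_word_end. Qed.

Lemma moves_back T (o : option T) h : isSome o = (0 < h) -> moves (back o) h h.-1.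
Proof. by case: o h => [t|] [|h] //= _; rewrite eqxx. Qed.

(** [m] bounds the cell numbers of all three heads. After one joint step to the left, each head
    stands on data or on its left blank; each walks to that blank and waits, and then all step right
    to cell [1]. *)
Lemma goes_rewind x k a r c m :
  0 < a <= m -> a <= (n * n.+1).+1 -> 0 < r <= m -> r <= n.+1 ->
  0 < c <= m -> c <= n.+1 ->
  goes m.+2 (rep (Rewind true k) (marked x) (marked x) a r c)
            (rep (after_rewind k) (marked x) (marked x) 1 1 1).
Proof.
move=> am an rm rn cm cn; apply: (goes_cons
  (Q := rep (Rewind false k) (marked x) (marked x) a.-1 r.-1 c.-1)).
  by apply: goes_scan; rewrite //=; lia.
have {am}: a.-1 <= m by lia.
have {rm}: r.-1 <= m by lia.
have {cm}: c.-1 <= m by lia.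
have {an}: a.-1 <= n * n.+1 by lia.
have {rn}: r.-1 <= n by lia.
have {cn}: c.-1 <= n by lia.
move: a.-1 r.-1 c.-1 => {}a {}r {}c cn rn an.
elim: m a r c cn rn an => [|m IH] a r c cn rn an cm rm am.
  have [-> -> ->] : [/\ a = 0, r = 0 & c = 0] by split; lia.
  exact: goes_scan.
have [/and3P[/eqP-> /eqP-> /eqP->]|nz] := boolP [&& a == 0, r == 0 & c == 0].
  by apply: (goes_weak (t := 1)) => //; apply: goes_scan.
have va : isSome (input a) = (0 < a) by rewrite input_isSome; lia.
have vr : isSome (marked x r) = (0 < r) by rewrite marked_isSome; lia.
have vc : isSome (marked x c) = (0 < c) by rewrite marked_isSome; lia.
apply: (goes_cons (Q :=
    rep (Rewind false k) (marked x) (marked x) a.-1 r.-1 c.-1)); last by apply: IH; lia.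
apply: (goes_scan (m0 := back (input a)) (m1 := back (marked x r))
  (m2 := back (marked x c))) => //; last by rewrite !moves_back.
by rewrite /delta va vr vc ifN //; lia.
Qed.

(** The first row of the matrix measures [n]: each of its bits creates one cell on both work tapes,
    and the first cell receives all the marks. *)
Lemma goes_init : 0 < n ->
  goes n.+1 (rep (Init true) (fun=> None) (fun=> None) 1 1 1)
    (rep (Rewind true None) (marked (fun=> 0)) (marked (fun=> 0))
         n.+1 n.+1 n.+1).
Proof.
move=> n_gt0.
pose f k h := if 0 < h <= k then Some (if h == 1 then setT else set0 : marks) else None.
have fn : f n =1 marked (fun=> 0).
  move=> h; rewrite /f /marked; case: ifP => // /andP[h_gt0 _]; congr Some.
  by apply/setP=> i; rewrite !inE; case: h h_gt0 => // -[|h]; rewrite !inE.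
suff fill k : k <= n -> goes k (rep (Init true) (fun=> None) (fun=> None) 1 1 1)
    (rep (Init (k == 0)) (f k) (f k) k.+1 k.+1 k.+1).
  apply: goes_rcons (fill n (leqnn n)) _.
  have sep := input_sep n_gt0; rewrite mul0n add0n in sep.
  apply: goes_step; [by [] | by rewrite /= sep | by rewrite /= eqxx | |];
    by move=> h; rewrite write_id fn.
elim: k => [_|k IH ltkn].
  by apply: goes_refl => C; apply: rep_ext => h; rewrite /f; case: h.
apply: goes_rcons (IH (ltnW ltkn)) _.
have bit := input_bit n_gt0 ltkn; rewrite mul0n add0n in bit.
have fS : write (f k) k.+1 (Some (if k == 0 then setT else set0)) =1 f k.+1.
  by move=> h; rewrite /write /f; have [->|ne] := eqVneq h k.+1;
    [rewrite ltnS leqnn eqSS | congr (if _ then _ else _); lia].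
by apply: goes_step; [by [] | by rewrite /= bit | by rewrite /= eqxx | |].
Qed.

(** * One sweep over the matrix *)

Definition row_views x r c : {set view} :=
  \bigcup_(j < c) [set (e r j, marks_at x r, marks_at x j)].

Definition views x r : {set view} := \bigcup_(i < r) row_views x i n.

Lemma goes_return x V Z a r k : k <= n ->
  goes k.+1 (rep (Return V Z) (marked x) (marked x) a r k)
            (rep (Sweep V Z) (marked x) (marked x) a r 1).
Proof.
elim: k => [_|k IH ltkn].
  by apply: goes_scan; [by [] | by [] | rewrite /= !eqxx].
apply: goes_cons (IH (ltnW ltkn)).
have mk : marked x k.+1 = Some (marks_at x k) by rewrite /marked ltkn.
by apply: goes_scan; [by [] | by rewrite /= mk | rewrite /= !eqxx].
Qed.

(** The bits take [n] steps, the separator one, and the return of the column head [n.+1]. *)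
Lemma goes_sweep_row x r V Z : r < n ->
  goes (n + n.+2)
    (rep (Sweep V Z) (marked x) (marked x) (r * n.+1).+1 r.+1 1)
    (rep (Sweep (V :|: row_views x r n) (marks_at x r)) (marked x) (marked x)
         (r.+1 * n.+1).+1 r.+2 1).
Proof.
move=> ltrn.
have mr : marked x r.+1 = Some (marks_at x r) by rewrite /marked ltrn.
have bits k : k <= n -> goes k
    (rep (Sweep V Z) (marked x) (marked x) (r * n.+1).+1 r.+1 1)
    (rep (Sweep (V :|: row_views x r k) Z) (marked x) (marked x)
         (r * n.+1 + k).+1 r.+1 k.+1).
  elim: k => [_|k IH ltkn].
    by apply: goes_refl => C; rewrite /row_views big_ord0 setU0 addn0.
  apply: goes_rcons (IH (ltnW ltkn)) _.
  rewrite [in row_views x r k.+1]/row_views big_ord_recr setUA addnS.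
  have mk : marked x k.+1 = Some (marks_at x k) by rewrite /marked ltkn.
  by apply: goes_scan; [by [] | by rewrite /= input_bit // mr mk | rewrite /= !eqxx].
apply: goes_trans (bits n (leqnn n)) _.
apply: (goes_cons (Q := rep (Return (V :|: row_views x r n) (marks_at x r))
  (marked x) (marked x) (r.+1 * n.+1).+1 r.+2 n)).
  have -> : (r.+1 * n.+1).+1 = (r * n.+1 + n).+2 by lia.
  by apply: goes_scan; [by [] | by rewrite /= input_sep // mr | rewrite /= !eqxx].
exact: goes_return.
Qed.

Lemma goes_sweep_rows x : 0 < n ->
  goes (n * (n + n.+2))
    (rep (Sweep set0 set0) (marked x) (marked x) 1 1 1)
    (rep (Sweep (views x n) (marks_at x n.-1)) (marked x) (marked x)
         (n * n.+1).+1 n.+1 1).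
Proof.
move=> n_gt0; pose last_marks r := if r is k.+1 then marks_at x k else set0.
have -> : marks_at x n.-1 = last_marks n by case: (n) n_gt0.
(* Induction on the number of rows swept; the occurrences of [n] that stand for the size of the
   matrix stay fixed. *)
have: n <= n by []; elim: {1 3 6 7 8 10}n => [_|r IH ltrn].
  by apply: goes_refl => C; rewrite /views big_ord0.
rewrite mulSnr; apply: goes_trans (IH (ltnW ltrn)) _.
by rewrite {2}/views big_ord_recr; apply: goes_sweep_row.
Qed.

Definition at_start x := rep (Sweep set0 set0) (marked x) (marked x) 1 1 1.

Definition at_end x := rep (after_sweep (views x n) (marks_at x n.-1))
  (marked x) (marked x) (n * n.+1).+1 n.+1 1.

Lemma goes_sweep x : 0 < n ->
  goes (n * (n + n.+2)).+1 (at_start x) (at_end x).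
Proof.
move=> n_gt0; rewrite /at_start /at_end.
apply: goes_rcons (goes_sweep_rows n_gt0) _.
by apply: goes_scan; [by [] | by rewrite /= input_end | rewrite /= !eqxx].
Qed.

(** * Passing to the next tuple *)

Definition next_tuple x (j : 'I_K) (i : 'I_K) : nat :=
  if i < j then 0 else if i == j then (x j).+1 else x i.

(** The condition in [pick] determines the digit: a smaller one is at its maximum, and a larger one
    would require [j] to be so. *)
Lemma after_sweep_next x (j : 'I_K) : good (views x n) ->
  (forall i : 'I_K, i < j -> x i = n.-1) -> x j != n.-1 ->
  after_sweep (views x n) (marks_at x n.-1) = Rewind true (Some j).
Proof.
move=> good_x max_x xj; rewrite /after_sweep good_x; case: pickP => [k|/(_ j)].
  case/andP=> xk /forallP min_k; congr (Rewind _ (Some _)); apply: val_inj => /=.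
  case: (ltngtP k j) => // [/max_x Dk|ltjk].
    by rewrite inE Dk eqxx in xk.
  by have := min_k j; rewrite ltjk inE (negPf xj).
rewrite inE xj /= => /forallP[] i; apply/implyP=> /max_x Di.
by rewrite inE Di.
Qed.

(** Here [h] counts cells from [0]. The flag [first] marks cell [0], where reset digits go; [carry]
    says that the previous cell held the mark [j]. *)
Lemma incr_marksE x (j : 'I_K) h :
  incr_marks j (h == 0) ((0 < h) && (x j == h.-1)) (marks_at x h) =
  marks_at (next_tuple x j) h.
Proof.
apply/setP=> i; rewrite !inE /next_tuple; case: (i < j) => //.
by case: (i == j) => //; case: h.
Qed.

Lemma goes_increment x (j : 'I_K) : x j < n.-1 ->
  goes n.+1 (rep (Increment j true false) (marked x) (marked x) 1 1 1)
    (rep (Rewind true None) (marked (next_tuple x j)) (marked (next_tuple x j))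
         1 n.+1 n.+1).
Proof.
move=> ltxj; pose f k h := if h <= k then marked (next_tuple x j) h else marked x h.
suff fill k : k <= n ->
    goes k (rep (Increment j true false) (marked x) (marked x) 1 1 1)
      (rep (Increment j (k == 0) ((0 < k) && (x j == k.-1))) (f k) (f k)
           1 k.+1 k.+1).
  apply: goes_rcons (fill n (leqnn n)) _.
  have fN : f n n.+1 = None by rewrite /f ltnn /marked ltnn.
  have fE : f n =1 marked (next_tuple x j).
    move=> h; rewrite /f; case: leqP => // lt_nh.
    by rewrite /marked [h <= n]leqNgt lt_nh andbF.
  apply: goes_step; [by [] | by rewrite /= fN | by rewrite /= !eqxx | |];
    by move=> h; rewrite -fN write_id fE.
elim: k => [_|k IH ltkn].
  by apply: goes_refl => C; apply: rep_ext => h; rewrite /f; case: h.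
apply: goes_rcons (IH (ltnW ltkn)) _.
have fk : f k k.+1 = Some (marks_at x k) by rewrite /f ltnn /marked ltkn.
have fS : write (f k) k.+1 (Some (marks_at (next_tuple x j) k)) =1 f k.+1.
  move=> h; rewrite /write /f; have [->|ne] := eqVneq h k.+1.
    by rewrite leqnn /marked ltkn.
  by congr (if _ then _ else _); lia.
by apply: goes_step; [by [] | by rewrite /= fk incr_marksE inE
                        | by rewrite /= !eqxx | exact: fS | exact: fS].
Qed.

Lemma goes_next x (j : 'I_K) : good (views x n) ->
  (forall i : 'I_K, i < j -> x i = n.-1) -> x j < n.-1 ->
  goes (4 * (n * n.+1) + 8) (at_end x) (at_start (next_tuple x j)).
Proof.
move=> good_x max_x ltxj.
have n_le : n <= n * n.+1 by lia.
rewrite /at_end (after_sweep_next good_x max_x); last by rewrite neq_ltn ltxj.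
(* The summands are the rewinding from the end of the input, the increment, and the rewinding from
   cell [n.+1]. *)
apply: (@goes_weak ((n * n.+1).+3 + (n.+1 + n.+3))); first by lia.
apply: goes_trans (goes_rewind (m := (n * n.+1).+1) _ _ _ _ _ _) _; try lia.
apply: goes_trans (goes_increment ltxj) _.
by apply: (goes_rewind (k := None) (m := n.+1)); lia.
Qed.

(** * The odometer *)

Definition bounded x := forall i, x i < n.

Definition agree_from k x y := forall i : 'I_K, k <= i -> y i = x i.

Definition halted b C := cstate C = Halt b.

Lemma views_ext x y : x =1 y -> views x n = views y n.
Proof.
move=> eqxy; have eqm r : marks_at x r = marks_at y r.
  by apply/setP=> i; rewrite !inE eqxy.
by apply: eq_bigr => r _; apply: eq_bigr => c _; rewrite !eqm.
Qed.

Lemma mem_views x v :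
  reflect (exists r c, [/\ r < n, c < n & v = (e r c, marks_at x r, marks_at x c)])
          (v \in views x n).
Proof.
apply: (iffP bigcupP) => [[r _ /bigcupP[c _ /set1P Dv]]|[r [c [ltr ltc ->]]]].
  by exists r, c.
exists (Ordinal ltr) => //; apply/bigcupP; exists (Ordinal ltc) => //.
exact: set11.
Qed.

Let next_time := 4 * (n * n.+1) + 8.
(** A round consists of a sweep, in [(n * (n + n.+2)).+1] steps, and a passage to the next tuple, in
    [next_time] steps. *)
Let round_time := 6 * (n * n.+1) + 9.

(* The odometer restricted to the digits below [k]. *)
Lemma goes_loop k x : 0 < n -> k <= K -> bounded x ->
  (forall i : 'I_K, i < k -> x i = 0) ->
  (exists y, [/\ bounded y, agree_from k x y & ~~ good (views y n)]) /\
    goes (n ^ k * round_time - next_time) (at_start x) (halted false)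
  \/ (forall y, bounded y -> agree_from k x y -> good (views y n)) /\
    exists z, [/\ bounded z, agree_from k x z, forall i : 'I_K, i < k -> z i = n.-1
      & goes (n ^ k * round_time - next_time) (at_start x) (at_end z)].
Proof.
move=> n_gt0; elim: k x => [|k IH] x ltkK bx x0.
  (* The last tuple of a loop is swept but not incremented, which is why [next_time] is
     subtracted. *)
  have sweep : goes (n ^ 0 * round_time - next_time) (at_start x) (at_end x).
    by apply: goes_weak (goes_sweep n_gt0); rewrite /round_time /next_time; lia.
  case good_x: (good (views x n)); [right | left]; split.
  - by move=> y _ eqxy; rewrite (@views_ext y x) // => i; apply: eqxy.
  - by exists x.
  - by exists x; rewrite good_x.
  - move=> C /sweep[t le_t [Dq _ _ _ _ _ _]]; exists t => //.
    by rewrite /halted Dq /after_sweep good_x.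
pose kk := Ordinal ltkK; set N := n ^ k * round_time in IH *.
have leN : next_time <= N.
  apply: leq_trans (leq_pmull _ _); last by rewrite expn_gt0 n_gt0.
  by rewrite /next_time /round_time; lia.
have agreeS y z : agree_from k y z -> agree_from k.+1 y z.
  by move=> eqyz i /ltnW; apply: eqyz.
(* Inner induction on the number [d] of increments left to digit [k]. Only tuples whose digit [k] is
   at least the current one are still to be tested. *)
suff loop d y : d = n.-1 - y kk -> bounded y -> (forall i : 'I_K, i < k -> y i = 0) ->
    (exists z, [/\ bounded z, agree_from k.+1 y z & ~~ good (views z n)]) /\
      goes (d.+1 * N - next_time) (at_start y) (halted false)
    \/ (forall z, bounded z -> agree_from k.+1 y z -> y kk <= z kk ->
         good (views z n)) /\
      exists z, [/\ bounded z, agree_from k.+1 y z,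
        forall i : 'I_K, i < k.+1 -> z i = n.-1
        & goes (d.+1 * N - next_time) (at_start y) (at_end z)].
  have xk : x kk = 0 by apply: x0 => /=.
  have xlt (i : 'I_K) : i < k -> x i = 0 by move/ltnW; apply: x0.
  have := loop n.-1 x; rewrite xk subn0 prednK // mulnA -expnS.
  case=> // [?|[good_x ?]]; [by left | right; split=> // y by_ xy].
  by apply: good_x; rewrite ?xk.
elim: d y => [|d IHd] y Dd by_ y0.
  have yk : y kk = n.-1 by have := by_ kk; lia.
  case: (IH y (ltnW ltkK) by_ y0) => [[[z [bz yz bad_z]] run]|[good_y [z [bz yz zmax run]]]].
    by left; split; [exists z; split=> //; apply: agreeS | rewrite mul1n].
  right; split=> [t bt yt le_yt|].
    apply: good_y => // i; rewrite leq_eqVlt => /predU1P[Di|/yt//].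
    have <- : kk = i by apply: val_inj.
    by have := bt kk; lia.
  exists z; split=> //; [exact: agreeS | move=> i | by rewrite mul1n].
  rewrite ltnS leq_eqVlt => /predU1P[Di|/zmax//].
  have -> : i = kk by apply: val_inj.
  by rewrite yz.
case: (IH y (ltnW ltkK) by_ y0) => [[[z [bz yz bad_z]] run]|[good_y [z [bz yz zmax run]]]].
  left; split; first by exists z; split=> //; apply: agreeS.
  by apply: goes_weak run; rewrite mulSn; lia.
have zk : z kk = y kk by apply: yz.
have good_z := good_y z bz yz.
(* The inner odometer stops with all lower digits maximal, so the next increment acts on digit [k]
   and resets them. Together this takes exactly the budget [N]. *)
have run' : goes N (at_start y) (at_start (next_tuple z kk)).
  rewrite -(subnK leN); apply: goes_trans run _; apply: goes_next => //.
  by rewrite zk; lia.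
set y' := next_tuple z kk in run'.
have y'k : y' kk = (y kk).+1 by rewrite /y' /next_tuple /= ltnn eqxx zk.
have yy' : agree_from k.+1 y y'.
  move=> i ltki; rewrite /y' /next_tuple /= ltnNge ltnW //= ifN; last first.
    by rewrite -val_eqE /= gtn_eqF.
  by apply: yz; apply: ltnW.
have by' : bounded y'.
  move=> i; rewrite /y' /next_tuple; case: ifP => // _; case: ifP => _ //.
  by rewrite zk; lia.
have y'0 (i : 'I_K) : i < k -> y' i = 0 by rewrite /y' /next_tuple /= => ->.
have time : N + (d.+1 * N - next_time) <= d.+2 * N - next_time.
  by rewrite [d.+2 * N]mulSn; have : next_time <= d.+1 * N; [rewrite mulSn; lia | lia].
have trans_agree t : agree_from k.+1 y' t -> agree_from k.+1 y t.
  by move=> y't i ltki; rewrite y't // yy'.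
case: (IHd y' _ by' y'0) => [|[[t [bt y't bad_t]] run'']|[good_y' [t [bt y't tmax run'']]]].
- by rewrite y'k; lia.
- left; split; first by exists t; split=> //; apply: trans_agree.
  by apply: goes_weak time _; apply: goes_trans run' run''.
- right; split=> [u bu yu le_yu|].
    move: le_yu; rewrite leq_eqVlt => /predU1P[yuk|ltyu].
      apply: good_y => // i; rewrite leq_eqVlt => /predU1P[Di|/yu//].
      have <- : kk = i by apply: val_inj.
      by [].
    by apply: good_y'; rewrite ?y'k // => i ltki; rewrite yu // yy'.
  exists t; split=> //; first exact: trans_agree.
  by apply: goes_weak time _; apply: goes_trans run' run''.
Qed.

(** * The whole run and its polynomial time bound *)

Lemma rep_init : rep (Init true) (fun=> None) (fun=> None) 1 1 1 (init tuple_machine w).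
Proof.
by split=> //= -[|h] //=; rewrite /pos ?subn1 //= /input; elim: (w) h => [|a s IH] [].
Qed.

(** For [s = n * n.+1] a round takes [6 * s + 9] steps; there are at most [n ^ K <= s ^ K] rounds,
    and one more pays for the initialization. *)
Definition total_time s := (6 * s + 9) * s ^ K + (6 * s + 9).

Lemma goes_decide : 0 < K ->
  exists2 b, goes (total_time (size w))
    (rep (Init true) (fun=> None) (fun=> None) 1 1 1) (halted b)
  & (b <-> forall x, bounded x -> good (views x n)).
Proof.
move=> K_gt0; rewrite size_matrix_word /total_time -/round_time.
have [n0|n_gt0] := posnP n.
  (* On empty input the machine accepts at once, and no tuple is bounded because [K] is positive. *)
  exists true.
    apply: (@goes_weak 1); first by rewrite /round_time; lia.
    have run : goes 1 (rep (Init true) (fun=> None) (fun=> None) 1 1 1)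
        (rep (Halt true) (fun=> None) (fun=> None) 1 1 1).
      have blank : input 1 = None by have := input_end; rewrite n0.
      by apply: goes_scan; [by [] | by rewrite /= blank | rewrite /= !eqxx].
    by move=> C /run[t le_t []]; exists t.
  by split=> // _ x /(_ (Ordinal K_gt0)); rewrite n0.
have start : goes round_time (rep (Init true) (fun=> None) (fun=> None) 1 1 1)
    (at_start (fun=> 0)).
  apply: (@goes_weak (n.+1 + n.+3)); first by rewrite /round_time; lia.
  apply: goes_trans (goes_init n_gt0) _.
  by apply: (goes_rewind (k := None) (m := n.+1)); lia.
have time : round_time + (n ^ K * round_time - next_time) <=
    round_time * (n * n.+1) ^ K + round_time.
  have : n ^ K * round_time <= (n * n.+1) ^ K * round_time.
    by rewrite leq_mul2r leq_exp2r // leq_pmulr ?orbT.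
  by rewrite [_ * round_time]mulnC [_ ^ K * round_time]mulnC; lia.
case: (@goes_loop K (fun=> 0)) => // [[[y [by_ _ bad_y]] run]|[good_all [z [bz _ zmax run]]]].
  exists false; first by apply: goes_weak time _; apply: goes_trans start run.
  by split=> // /(_ y by_); rewrite (negPf bad_y).
have good_x x : bounded x -> good (views x n).
  by move=> bx; apply: good_all => // i; rewrite leqNgt ltn_ord.
exists true => //.
have {}run := goes_weak time (goes_trans start run).
move=> C /run[t le_t [Dq _ _ _ _ _ _]]; exists t => //.
rewrite /halted Dq /after_sweep good_x //; case: pickP => // j.
by rewrite inE zmax ?eqxx.
Qed.

Lemma tuple_machine_halts : 0 < K ->
  exists2 b, halts_within tuple_machine w (total_time (size w)) b
  & (b <-> forall x, bounded x -> good (views x n)).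
Proof.
case/goes_decide=> b run Db; exists b => //.
have [t le_t Dq] := run _ rep_init.
rewrite /halts_within -(subnK le_t) iterD.
(* Halting configurations are fixed, so a bound on the halting time suffices. *)
suff fixed m C : halted b C -> iter m (@step _ tuple_machine) C = C.
  by rewrite fixed // Dq.
by move=> DC; elim: m => //= m ->; rewrite /step DC.
Qed.

End Execution.
End TupleMachine.

(** The interface to graph theory: the machine and the polynomial depend on [K] and [good] alone,
    not on the matrix. *)
Lemma polytime_forall_tuples K (good : {set bool * {set 'I_K} * {set 'I_K}} -> bool) :
  0 < K -> exists (M : machine (option bool)) (p : {poly nat}),
    forall n e, let w := matrix_word n e in
      exists2 b, halts_within M w p.[size w]%R b
      & (b <-> forall x : 'I_K -> nat, bounded n x -> good (views n e x n)).
Proof.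
move=> K_gt0; exists (tuple_machine good).
exists ((6%:P * 'X + 9%:P) * 'X^K + (6%:P * 'X + 9%:P))%R => n e w.
have [b run Db] := tuple_machine_halts good n e K_gt0; exists b => //.
suff -> : ((6%:P * 'X + 9%:P) * 'X^K + (6%:P * 'X + 9%:P) : {poly nat}).[size w]%R =
  total_time K (size w) by [].
by rewrite !(hornerD, hornerM, hornerC, hornerX, hornerXn).
Qed.

(** * Components of path-free graphs of bounded degree *)

Section Ball.
Variable G : sgraph.
Implicit Types (u v x y : G) (k : nat).

Definition nbhd_of (S : {set G}) : {set G} := \bigcup_(x in S) closed_nbhd x.

Definition ball k v : {set G} := iter k nbhd_of [set v].

Lemma mem_nbhd_of (S : {set G}) y :
  reflect (exists2 x, x \in S & (y == x) || edge x y) (y \in nbhd_of S).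
Proof.
apply: (iffP bigcupP) => [[x xS]|[x xS xy]]; first by rewrite inE; exists x.
by exists x => //; rewrite inE.
Qed.

Lemma sub_nbhd_of (S : {set G}) : S \subset nbhd_of S.
Proof. by apply/subsetP=> x xS; apply/mem_nbhd_of; exists x; rewrite ?eqxx. Qed.

Lemma ball_edge k v x y : x \in ball k v -> edge x y -> y \in ball k.+1 v.
Proof. by move=> xB xy; apply/mem_nbhd_of; exists x; rewrite ?xy ?orbT. Qed.

Lemma ball_sub j k v : j <= k -> ball j v \subset ball k v.
Proof.
elim: k => [|k IH]; first by rewrite leqn0 => /eqP->.
rewrite leq_eqVlt ltnS => /predU1P[-> //|/IH sub].
exact: subset_trans sub (sub_nbhd_of _).
Qed.

Lemma card_nbhd_of d (S : {set G}) :
  max_degree G <= d -> #|nbhd_of S| <= #|S| * d.+1.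
Proof.
move=> maxd; rewrite -sum_nat_const /nbhd_of.
elim/big_rec2: _ => [|x m S' _ leSm]; first by rewrite cards0.
apply: leq_trans (leq_card_setU _ _) _; apply: leq_add leSm.
have -> : closed_nbhd x = x |: [set u | edge x u] by apply/setP=> u; rewrite !inE.
rewrite cardsU1 -add1n leq_add ?leq_b1 //.
exact: leq_trans (leq_bigmax (F := @degree G) x) maxd.
Qed.

Lemma card_ball d k v : max_degree G <= d -> #|ball k v| <= d.+1 ^ k.
Proof.
move=> maxd; elim: k => [|k IH]; first by rewrite cards1.
apply: leq_trans (card_nbhd_of _ maxd) _.
by rewrite expnSr leq_mul2r IH orbT.
Qed.

(* Walking back from [u], every vertex of the walk first enters the balls at
   its own index, which makes the walk an induced path. *)
Lemma geodesic k v u : u \in ball k.+1 v -> u \notin ball k v ->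
  exists p : nat -> G, [/\ p 0 = v, p k.+1 = u,
    forall i, i <= k -> edge (p i) (p i.+1),
    forall i, i <= k.+1 -> p i \in ball i v &
    forall i, i <= k -> p i.+1 \notin ball i v].
Proof.
elim: k u => [|k IH] u uB uNB.
  case/mem_nbhd_of: (uB) => x; rewrite inE => /eqP-> {x}.
  rewrite inE in uNB; rewrite (negPf uNB) /= => vu.
  exists (fun i => if i is 0 then v else u); split=> //.
  - by case.
  - by case=> [|[]] //; rewrite inE.
  - by case=> //; rewrite inE.
case/mem_nbhd_of: (uB) => x xB /predU1P[eux|xu]; first by rewrite eux xB in uNB.
have xNB : x \notin ball k v.
  by apply: contra uNB => xB'; apply: ball_edge xB' xu.
have [p [p0 px pe pB pNB]] := IH x xB xNB.
exists (fun i => if i <= k.+1 then p i else u); split=> //.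
- by rewrite ltnn.
- move=> i leik; rewrite leik; move: leik.
  rewrite leq_eqVlt => /predU1P[->|ltik]; first by rewrite ltnn px.
  by rewrite ltik pe.
- by move=> i leik; case: ifP => [/pB//|]; have [->|] : i = k.+2 \/ i <= k.+1; lia.
- by move=> i leik; case: ifP => [/pNB//|]; have [->|] : i = k.+1 \/ i <= k; lia.
Qed.

Lemma induced_path_not_free m (p : 'I_m -> G) : injective p ->
  (forall i j, edge (p i) (p j) = path_edge i j) ->
  ~ induced_free (path_graph m) G.
Proof.
move=> p_inj p_edge free; apply: (free [set x in codom p]).
have p_in i : p i \in [set x in codom p] by rewrite inE codom_f.
pose h i : induced [set x in codom p] := exist _ (p i) (p_in i).
have h_inj : injective h by move=> i j /(congr1 val)/p_inj.
have h_surj z : exists i, h i == z.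
  case: z => y yp; have := yp; rewrite inE => /codomP[i Di].
  by exists i; rewrite -val_eqE /= Di.
(* [isomorphic] asks for a map from the induced subgraph to the path, hence the inverse of [p] on
   its image. *)
pose f z := xchoose (h_surj z).
have fK : cancel f h by move=> z; apply/eqP; apply: (xchooseP (h_surj z)).
exists f; first by exists h => // i; apply: h_inj; rewrite fK.
by move=> z t; rewrite -[in RHS](fK z) -[in RHS](fK t) /= /induced_edge /= p_edge.
Qed.

(** A vertex first reached in round [k.+1] ends a walk on [k.+2] vertices whose [j]-th vertex lies
    in no ball of radius below [j]. A repetition or a chord would put a vertex into too small a
    ball, so the walk is an induced path. *)
Lemma path_free_ball k v :
  induced_free (path_graph k.+2) G -> ball k.+1 v \subset ball k v.
Proof.
move=> free; apply/subsetPn => -[u uB uNB].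
have [p [p0 pu pe pB pNB]] := geodesic uB uNB.
have far (i j : nat) : i < j -> j <= k.+1 -> p j \notin ball i v.
  case: j => // j; rewrite !ltnS => leij lejk.
  by apply: contra (pNB j lejk); apply/subsetP/ball_sub.
have no_chord (i j : nat) : i.+1 < j -> j <= k.+1 -> ~~ edge (p i) (p j).
  move=> ltij lejk; apply: contra (far _ _ ltij lejk); apply: ball_edge.
  by apply: pB; lia.
pose q (i : 'I_k.+2) := p i.
have lek (i : 'I_k.+2) : i <= k.+1 by rewrite -ltnS.
have q_inj : injective q.
  suff neq (i j : 'I_k.+2) : i < j -> q i <> q j.
    by move=> i j eqij; apply/val_inj; case: (ltngtP i j) => // /neq; rewrite eqij.
  by move=> ltij eqij; have := far _ _ ltij (lek j); rewrite -/(q j) -eqij pB.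
apply: (@induced_path_not_free _ q q_inj) free => i j.
wlog leij : i j / i <= j.
  move=> H; case: (leqP i j) => [|/ltnW] /H //.
  by rewrite edge_sym path_edge_sym.
rewrite /path_edge /q; have := lek j.
case: (ltngtP i.+1 j) => [ltij lejk|ltji|eqij].
- by rewrite (negPf (no_chord _ _ ltij lejk)); lia.
- have -> : j = i by apply: val_inj => /=; lia.
  by rewrite edge_irrefl; lia.
- by rewrite -eqij => ltik; rewrite pe.
Qed.

Lemma connect_ball k v : induced_free (path_graph k.+2) G ->
  [set u | connect (@edge G) v u] \subset ball k v.
Proof.
move=> /(path_free_ball v)/subsetP cl; apply/subsetP=> u; rewrite inE.
have vB : v \in ball k v by apply: (subsetP (ball_sub v (leq0n k))); rewrite inE.
(* The start of the path is generalized while the centre of the ball stays [v]. *)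
case/connectP=> p pp ->; move: {1 3 4}v vB pp => z.
elim: p z => //= y p IH z zB /andP[zy]; apply: IH.
by apply: cl; apply: ball_edge zB zy.
Qed.

Lemma card_component k d v :
  induced_free (path_graph k.+2) G -> max_degree G <= d ->
  #|[set u | connect (@edge G) v u]| <= d.+1 ^ k.
Proof.
move=> free maxd; apply: leq_trans (card_ball k v maxd).
exact/subset_leq_card/connect_ball.
Qed.

End Ball.

(** * Efficient domination tested on closed tuples *)

Section LocalEds.
Variables (G : sgraph) (K : nat).
Implicit Types (x : 'I_K -> G) (B : {set 'I_K}).

Definition closed_tuple x :=
  forall i v, edge (x i) v -> exists j, v = x j.

(** A tuple may repeat vertices, so the dominator is unique as a vertex, not as an index. *)
Definition local_eds x B :=
  [forall i, [exists j in B, x j \in closed_nbhd (x i)] &&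
    [forall j in B, forall k in B, (x j \in closed_nbhd (x i)) ==>
       (x k \in closed_nbhd (x i)) ==> (x j == x k)]].

(** An e.d.s. restricts to a closed tuple because the tuple contains all dominators of its entries.
    Conversely, each component is listed by a closed tuple, and the local solutions are glued. *)
Lemma has_eds_local :
  (forall v, #|[set u | connect (@edge G) v u]| <= K) ->
  has_eds G <-> (forall x, closed_tuple x -> exists B, local_eds x B).
Proof.
move=> leK; split=> [[D eds] x clx|loc].
  exists [set j | x j \in D]; apply/forallP=> i.
  have /eqP/cards1P[d Dd] := eds (x i).
  have memd u : (u \in closed_nbhd (x i)) && (u \in D) = (u == d).
    by rewrite -in_setI Dd inE.
  apply/andP; split.
    have := eqxx d; rewrite -memd => /andP[dN dD].
    have [j Dj] : exists j, d = x j.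
      by move: dN; rewrite inE => /predU1P[->|/clx//]; exists i.
    by apply/existsP; exists j; rewrite inE -Dj dD.
  apply/forall_inP=> j; rewrite inE => jD; apply/forall_inP=> k.
  rewrite inE => kD; apply/implyP=> jN; apply/implyP=> kN.
  have := memd (x j); have := memd (x k); rewrite jN kN jD kD.
  by move=> /esym/eqP-> /esym/eqP->.
have csym : connect_sym (@edge G) by apply/sym_connect_sym/edge_sym.
pose comp v := [set u | connect (@edge G) v u].
(* Components with fewer than [K] vertices are padded by repeating [v]. *)
pose x v (i : 'I_K) := nth v (enum (comp v)) i.
have x_comp v i : x v i \in comp v.
  rewrite /x; case: (ltnP i (size (enum (comp v)))) => lti.
    by rewrite -mem_enum mem_nth.
  by rewrite nth_default // inE connect0.
have x_surj v u : u \in comp v -> exists i, u = x v i.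
  rewrite -mem_enum => uv; have ltK : index u (enum (comp v)) < K.
    by apply: leq_trans (leK v); rewrite cardE index_mem.
  by exists (Ordinal ltK); rewrite /x nth_index.
have x_closed v : closed_tuple (x v).
  move=> i u xu; apply: x_surj; have := x_comp v i; rewrite !inE => vx.
  exact: connect_trans vx (connect1 xu).
have exB v : exists B, local_eds (x v) B by apply/loc/x_closed.
pose D_ v := [set x v j | j in xchoose (exB v)].
(* A canonical root makes all vertices of a component use the same local solution. *)
pose rt v := fingraph.root (@edge G) v.
have rt_edge v u : u \in closed_nbhd v -> rt u = rt v.
  rewrite inE => /predU1P[->//|vu]; apply/esym/(fingraph.rootP csym).
  exact: connect1.
exists [set u | u \in D_ (rt u)] => v; apply/eqP/cards1P.
have [i Di] : exists i, v = x (rt v) i.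
  by apply: x_surj; rewrite inE csym connect_root.
have /forallP/(_ i) := xchooseP (exB (rt v)); rewrite -Di.
case/andP=> /exists_inP[j jB jN] /forall_inP uniq_j.
exists (x (rt v) j); apply/setP=> u; rewrite in_setI in_set1.
apply/andP/eqP=> [[uN]|->]; rewrite inE.
  rewrite (rt_edge _ _ uN) => /imsetP[k kB Dk].
  have /forall_inP/(_ j jB)/implyP := uniq_j k kB.
  by rewrite -Dk => /(_ uN)/implyP/(_ jN)/eqP.
by split=> //; rewrite (rt_edge _ _ jN); apply: imset_f.
Qed.

End LocalEds.

(** * Recovering the induced subgraph from the collected views *)

Section Views.
Variables (K : nat) (V : {set bool * {set 'I_K} * {set 'I_K}}).

Definition same_view (i j : 'I_K) :=
  [exists v in V, (i \in v.1.2) && (j \in v.1.2)].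

Definition adjacent_view (i j : 'I_K) :=
  [exists v in V, [&& v.1.1, i \in v.1.2 & j \in v.2]].

Definition near_view (i j : 'I_K) := same_view j i || adjacent_view i j.

(** An edge from a marked row to an unmarked column exhibits a neighbour missing from the tuple. *)
Definition closed_view :=
  [forall v in V, v.1.1 ==> (v.1.2 != set0) ==> (v.2 != set0)].

Definition eds_view (B : {set 'I_K}) :=
  [forall i, [exists j in B, near_view i j] &&
    [forall j in B, forall k in B, near_view i j ==> near_view i k ==>
       same_view j k]].

End Views.

Section GraphMatrix.
Variable G : sgraph.

(** The existential form is total on [nat] without a default vertex, so the empty graph is
    covered. *)
Definition rank_edge (r c : nat) : bool :=
  [exists u : G, exists v : G,
    [&& enum_rank u == r :> nat, enum_rank v == c :> nat & edge u v]].

Lemma rank_edgeE (u v : G) : rank_edge (enum_rank u) (enum_rank v) = edge u v.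
Proof.
apply/existsP/idP => [[u' /existsP[v' /and3P[]]]|uv].
  by move=> /eqP/val_inj/enum_rank_inj-> /eqP/val_inj/enum_rank_inj->.
by exists u; apply/existsP; exists v; rewrite !eqxx.
Qed.

Lemma map_enum_rank : [seq val (enum_rank u) | u <- enum G] = iota 0 #|G|.
Proof.
apply: (@eq_from_nth _ 0); first by rewrite size_map -cardE size_iota.
move=> i; rewrite size_map -cardE => lti.
have v0 := enum_val (Ordinal lti).
rewrite (nth_map v0) -?cardE // nth_iota // add0n.
by rewrite -[nth _ _ _]/(nth v0 _ (Ordinal lti)) -enum_val_nth enum_valK.
Qed.

Lemma encode_matrix_word : encode G = matrix_word #|G| rank_edge.
Proof.
rewrite /matrix_word -map_enum_rank -map_comp; congr flatten; apply: eq_map => u /=.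
by rewrite -map_comp; congr rcons; apply: eq_map => v /=; rewrite rank_edgeE.
Qed.

Variables (K : nat) (X : 'I_K -> G).

Let x i : nat := enum_rank (X i).
Let V := views #|G| rank_edge x #|G|.

(** Matrix cells are pairs of vertices, and the marks of a vertex are its fibre under [X]. *)
Let mem_V v : reflect (exists u u',
    v = (edge u u', [set i | X i == u], [set i | X i == u'])) (v \in V).
Proof.
have marksE u : marks_at x (enum_rank u) = [set i | X i == u].
  by apply/setP=> i; rewrite !inE val_eqE (inj_eq enum_rank_inj).
apply: (iffP (mem_views _ _ _ _)) => [[r [c [ltr ltc ->]]]|[u [u' ->]]].
  exists (enum_val (Ordinal ltr)), (enum_val (Ordinal ltc)).
  by rewrite -rank_edgeE -!marksE !enum_valK.
by exists (enum_rank u), (enum_rank u'); rewrite !ltn_ord rank_edgeE !marksE.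
Qed.

Lemma same_viewE i j : same_view V i j = (X i == X j).
Proof.
apply/exists_inP/eqP => [[_ /mem_V[u [u' ->]]]|Xij].
  by rewrite !inE => /andP[/eqP-> /eqP->].
exists (edge (X i) (X i), [set k | X k == X i], [set k | X k == X i]).
  by apply/mem_V; exists (X i), (X i).
by rewrite !inE Xij eqxx.
Qed.

Lemma adjacent_viewE i j : adjacent_view V i j = edge (X i) (X j).
Proof.
apply/exists_inP/idP => [[_ /mem_V[u [u' ->]]]|Xij].
  by rewrite !inE => /and3P[uu' /eqP-> /eqP->].
exists (edge (X i) (X j), [set k | X k == X i], [set k | X k == X j]).
  by apply/mem_V; exists (X i), (X j).
by rewrite !inE Xij !eqxx.
Qed.

Lemma eds_viewE B : eds_view V B = local_eds X B.
Proof.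
have near i j : near_view V i j = (X j \in closed_nbhd (X i)).
  by rewrite inE /near_view same_viewE adjacent_viewE.
rewrite /eds_view /local_eds; apply: eq_forallb => i; congr andb.
  by apply: eq_existsb => j; rewrite near.
apply: eq_forallb => j; congr implb; apply: eq_forallb => k.
by rewrite !near same_viewE.
Qed.

Lemma closed_viewP : reflect (closed_tuple X) (closed_view V).
Proof.
apply: (iffP forall_inP) => [cl i u Xu|cl _ /mem_V[u [u' ->]] /=].
  have /cl /= : (edge (X i) u, [set k | X k == X i], [set k | X k == u]) \in V.
    by apply/mem_V; exists (X i), u.
  have i_in : [set k | X k == X i] != set0 by apply/set0Pn; exists i; rewrite inE.
  by rewrite Xu i_in => /set0Pn[j]; rewrite inE => /eqP <-; exists j.
apply/implyP=> uu'; apply/implyP=> /set0Pn[i]; rewrite inE => /eqP Xi.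
have [|j ->] := cl i u'; first by rewrite Xi.
by apply/set0Pn; exists j; rewrite inE.
Qed.

End GraphMatrix.

(** * The test on views and the decision procedure *)

Definition component_test K (V : {set bool * {set 'I_K} * {set 'I_K}}) :=
  closed_view V ==> [exists B, eds_view V B].

Lemma has_eds_views (G : sgraph) K :
  (forall v : G, #|[set u | connect (@edge G) v u]| <= K) ->
  (forall x : 'I_K -> nat, bounded #|G| x ->
     component_test (views #|G| (@rank_edge G) x #|G|)) <-> has_eds G.
Proof.
move=> leK; rewrite (has_eds_local leK); split=> [test X clX|loc x bx].
  have := test _ (fun i => ltn_ord (enum_rank (X i))).
  rewrite /component_test; move/closed_viewP: clX => -> /existsP[B].
  by rewrite eds_viewE; exists B.
(* Bounded tuples of numbers are the rank tuples of vertices. *)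
pose X i : G := enum_val (Ordinal (bx i)).
have <- : views #|G| (@rank_edge G) (fun i => enum_rank (X i)) #|G| =
          views #|G| (@rank_edge G) x #|G|.
  by apply: views_ext => i; rewrite enum_valK.
apply/implyP=> /closed_viewP/loc[B edsB]; apply/existsP; exists B.
by rewrite eds_viewE.
Qed.

Theorem theorem14 :
  polytime_solvable_on has_eds
    (fun G : sgraph =>
       [/\ induced_free (path_graph 9) G, bipartite G & max_degree G <= 3]).
Proof.
(* The bound must be uniform in the graph, since it fixes the machine; [path_graph 9] is the case
   [k = 7] of [card_component]. *)
have [K K_gt0 leK] : exists2 K, 0 < K & forall G : sgraph,
    induced_free (path_graph 9) G -> max_degree G <= 3 ->
    forall v : G, #|[set u | connect (@edge G) v u]| <= K.
  by exists (4 ^ 7); rewrite ?expn_gt0 // => G free deg v; apply: card_component.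
have [M [p decides]] := polytime_forall_tuples (@component_test K) K_gt0.
exists M, p => G [free _ deg]; rewrite encode_matrix_word.
have [b run Db] := decides #|G| (@rank_edge G); exists b => //.
by rewrite Db; apply: has_eds_views; apply: leK.
Qed.
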